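(* Let $\lambda$ be a partition with $n$ parts, at least one equal to $0$, let $x_1,\dots,x_n>0$, $t\in[0,1)$, and fix $k<n$. Let $O$ be any observable (event or random variable) of the configuration of the multispecies $t$-PushTASEP with content $\lambda$ that depends only on the configuration in sites $1,2,\dots,k$. Then the expectation (or probability) $\langle O\rangle$ of $O$ in the stationary distribution is symmetric in the parameters $x_{k+1},\dots,x_n$.
   Context: Sites $1,\dots,n$ ($n\ge 2$) lie on a ring with clockwise order $1\to2\to\cdots\to n\to1$. For a partition $\lambda$, $S_\lambda$ is the set of compositions $\eta=(\eta_1,\dots,\eta_n)$ that are rearrangements of $\lambda$; $\eta_j$ is the species at site $j$, species $0$ meaning vacancy. Write $[m]_t=1+t+\dots+t^{m-1}$. The multispecies $t$-PushTASEP with content $\lambda$ is the continuous-time Markov chain on $S_\lambda$ in which each site $j$ has an independent exponential clock (bell) of rate $1/x_j$. When the bell at $j$ rings in configuration $\eta$: if $\eta_j=0$ nothing changes. Otherwise the particle at $j$ becomes active. An active particle of species $r$ at site $p$: let $m$ be the number of parts of $\lambda$ smaller than $r$; list the $m$ sites $i$ with $\eta_i<r$ (values before the bell rang) in clockwise order starting from the site after $p$; the particle moves to the $k$-th listed site with probability $t^{k-1}/[m]_t$, displacing the particle there; if the displaced species is nonzero that particle becomes active there and repeats, otherwise the procedure stops. Afterwards site $j$ is vacant, each site where an active particle settled holds it, other sites are unchanged; this is one transition. The stationary distribution is that of this (irreducible) chain. *)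

(* Defs.v *)
From HB Require Import structures.
From mathcomp Require Import all_boot all_order all_algebra all_fingroup.
From mathcomp Require Import reals.

Set Implicit Arguments.
Unset Strict Implicit.
Unset Printing Implicit Defensive.

Import Order.TTheory GRing.Theory Num.Theory.
Local Open Scope ring_scope.

(* Sites 1, ..., n are the ordinals 0, ..., n - 1 of 'I_n; the clockwise      *)
(* neighbour of a site is its cyclic successor ordS.                          *)

(* The set S_lambda of rearrangements of lam. *)
Record config (n : nat) (lam : n.-tuple nat) := Config {
  species :> {ffun 'I_n -> nat};
  configP : perm_eq (codom species) lam }.

HB.instance Definition _ (n : nat) (lam : n.-tuple nat) :=
  [isSub for @species n lam].
HB.instance Definition _ (n : nat) (lam : n.-tuple nat) :=
  [Countable of config lam by <:].

Section ConfigFinite.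
Variables (n : nat) (lam : n.-tuple nat).

Definition config_enum : seq (config lam) :=
  undup (pmap (fun s : seq nat => insub [ffun i : 'I_n => nth 0%N s i])
              (permutations lam)).

Lemma config_enumP : Finite.axiom config_enum.
Proof.
apply: Finite.uniq_enumP; first exact: undup_uniq.
move=> eta; rewrite mem_undup mem_pmap; apply/mapP.
exists (codom eta); first by rewrite mem_permutations configP.
rewrite (_ : [ffun _ => _] = species eta) ?valK //.
apply/ffunP=> i; rewrite ffunE codomE (nth_map i) ?size_enum_ord //.
by rewrite nth_ord_enum.
Qed.

HB.instance Definition _ := isFinite.Build (config lam) config_enumP.
End ConfigFinite.

Section Dynamics.
Variables (R : realType) (n : nat) (t : R).
Implicit Types (eta zeta cur : {ffun 'I_n -> nat}) (p j : 'I_n).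

Definition qint (m : nat) : R := \sum_(i < m) t ^+ i.

Definition set_site cur p (r : nat) : {ffun 'I_n -> nat} :=
  [ffun i => if i == p then r else cur i].

(* traject lists all n sites clockwise from the one after p, ending with p,   *)
(* which the strict inequality discards.                                      *)
Definition weaker_sites eta p : seq 'I_n :=
  [seq i <- traject (@ordS n) (ordS p) n | (eta i < eta p)%N].

(* Probability that the cascade ends in zeta, when eta is the configuration   *)
(* before the bell, cur the configuration built so far, and the particle of   *)
(* species eta p has just been removed from p by the bell or by displacement. *)
(* Each displaced particle is still where it was in eta, because a cascade    *)
(* never visits a site twice. List positions start at 0, hence t ^+ i. The    *)
(* species of successive active particles strictly decrease, so fuel larger   *)
(* than eta p is never exhausted.                                             *)
Fixpoint cascade_prob (fuel : nat) eta p cur zeta : R :=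
  if fuel is fuel'.+1 then
    if eta p == 0%N then (cur == zeta)%:R
    else
      let s := weaker_sites eta p in
      \sum_(i < size s)
        t ^+ i / qint (size s) *
        (let q := nth p s i in
         cascade_prob fuel' eta q (set_site cur q (eta p)) zeta)
  else 0.

Definition bell_prob j eta zeta : R :=
  cascade_prob (eta j).+1 eta j (set_site eta j 0) zeta.

End Dynamics.

Section Stationary.
Variables (R : realType) (n : nat) (lam : n.-tuple nat) (t : R).
Variable x : 'I_n -> R.

Definition jump_rate (eta zeta : config lam) : R :=
  \sum_(j < n) (x j)^-1 * bell_prob t j eta zeta.

Definition generator (eta zeta : config lam) : R :=
  if eta == zeta then - \sum_(xi | xi != eta) jump_rate eta xi
  else jump_rate eta zeta.

Definition is_stationary (pi : config lam -> R) : Prop :=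
  [/\ forall eta, 0 <= pi eta,
      \sum_eta pi eta = 1
    & forall zeta, \sum_eta pi eta * generator eta zeta = 0].

End Stationary.

Section Observables.
Variables (R : realType) (n : nat) (lam : n.-tuple nat).

Definition expectation (pi : config lam -> R) (O : config lam -> R) : R :=
  \sum_eta pi eta * O eta.

Definition probability (pi : config lam -> R) (A : {set config lam}) : R :=
  \sum_(eta in A) pi eta.

Definition depends_on_first (T : Type) (k : nat) (O : config lam -> T) : Prop :=
  forall eta zeta : config lam,
    (forall i : 'I_n, (i < k)%N -> eta i = zeta i) -> O eta = O zeta.

End Observables.

(* Main.v *)
Require Import Defs.
From HB Require Import structures.
From mathcomp Require Import all_boot all_order all_algebra all_fingroup.
From mathcomp Require Import reals ring lra zify.

(* Write B_j for the operator "ring the bell at j" on functions of the        *)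
(* configuration, so that with rates r_j = 1 / x_j the generator is           *)
(* L_r = sum_j r_j (B_j - 1). The geometric choice of a target means that an  *)
(* active particle walks clockwise and settles at each weaker site it meets   *)
(* with probability 1 - t, as long as it takes. Storing the species of the    *)
(* active particle at the bell site, one turn around the ring is a product of *)
(* two-site operators V_(j,k), and B_j f is the unique function fixed by that *)
(* product which agrees with f on the configurations vacant at j. The V_(j,k) *)
(* satisfy the Yang-Baxter equation, and T = V_(i,i+1) followed by the        *)
(* exchange of the two sites is a Hecke generator. Hence T commutes with B_j  *)
(* for j <> i, i+1, and                                                       *)
(*   B_i T = T B_(i+1),   B_(i+1) (T - (1 - t)) = (T - (1 - t)) B_i.          *)
(* With a = r_i, b = r_(i+1) and Q = b (1 - t) + (a - b) T this yields        *)
(* L_r Q = Q L_r', where r' is r with r_i and r_(i+1) exchanged. Since Q acts *)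
(* as the scalar a - t b on functions that do not distinguish sites i and     *)
(* i+1, stationary means of such functions are the same for r and r'. If the  *)
(* scalar vanishes, exchange the roles of r and r': both scalars cannot be 0. *)
(* That every function has exactly one mean follows from the maximum          *)
(* principle: letting every particle settle at the first weaker site, ringing *)
(* all bells once in clockwise order sorts the configuration, so that every   *)
(* configuration leads to the same one.                                       *)

Set Implicit Arguments.
Unset Strict Implicit.
Unset Printing Implicit Defensive.

Import Order.TTheory GRing.Theory Num.Theory.
Local Open Scope ring_scope.

Section Transpositions.
Local Open Scope nat_scope.
Variable n : nat.
Implicit Types (i k : 'I_n) (s u : {perm 'I_n}).

Lemma val_ordS i : i.+1 < n -> ordS i = i.+1 :> nat.
Proof. exact: modn_small. Qed.

Lemma ordS_neq i : i.+1 < n -> i != ordS i.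
Proof. by move=> Si_n; rewrite -val_eqE /= modn_small // ltn_eqF. Qed.

Variables (m : nat) (P : {perm 'I_n} -> Prop).
Hypotheses (P1 : P 1%g) (PM : forall s u, P s -> P u -> P (s * u)%g).
Hypothesis P_adjacent :
  forall i, m <= i -> i.+1 < n -> P (tperm i (ordS i)).

Lemma tperm_adjacent_ind i k : m <= i -> i < k -> P (tperm i k).
Proof.
have [d] := ubnP (k - i); elim: d i => // d IHd i.
rewrite ltnS => kid mi ik.
have Si_n : i.+1 < n by apply: leq_ltn_trans ik (ltn_ord k).
have Padj := P_adjacent mi Si_n.
have [-> //|k_neq] := eqVneq k (ordS i).
have Sk : ordS i < k by rewrite ltn_neqAle eq_sym k_neq val_ordS.
have PSk : P (tperm (ordS i) k).
  by apply: IHd => //; rewrite val_ordS //; lia.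
have -> : tperm i k = (tperm (ordS i) k ^ tperm i (ordS i))%g.
  rewrite tpermJ tpermR tpermD // 1?eq_sym //.
  by rewrite -val_eqE gtn_eqF.
by rewrite conjgE tpermV; apply: PM; [|apply: PM].
Qed.

Lemma perm_adjacent_ind s : (forall i, i < m -> s i = i) -> P s.
Proof.
have [d] := ubnP #|[pred i | s i != i]|; elim: d s => // d IHd s.
rewrite ltnS => moved s_fix.
have [i /= si|s_id] := pickP [pred i | s i != i]; last first.
  suff -> : s = 1%g by [].
  by apply/permP => i; rewrite perm1; apply/eqP/negbFE/s_id.
have mi : m <= i by rewrite leqNgt; apply: contra si => /s_fix ->.
have msi : m <= s i by rewrite leqNgt; apply: contra si => /s_fix/perm_inj ->.
pose u := tperm i (s i); pose s' := (s * u)%g.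
have s'_fix j : s j = j -> s' j = j.
  move=> sj; rewrite permM sj tpermD //.
    by apply: contraNneq si => ->; rewrite sj.
  by apply: contraNneq si => e; rewrite e (perm_inj (etrans e (esym sj))).
have Pu : P u.
  case: (ltngtP i (s i)) => [i_si|si_i|/val_inj e].
  - exact: tperm_adjacent_ind.
  - by rewrite /u tpermC; apply: tperm_adjacent_ind.
  - by rewrite -e eqxx in si.
have -> : s = (s' * u)%g by rewrite -mulgA tperm2 mulg1.
apply: PM => //; apply: IHd => [|j /s_fix]; last exact: s'_fix.
apply: leq_trans moved; apply: proper_card; apply/properP; split.
  by apply/subsetP => j; rewrite !inE; apply: contra => /eqP/s'_fix ->.
by exists i; rewrite !inE // permM /u tpermR eqxx.
Qed.

End Transpositions.

Lemma limg_addv_line (K : fieldType) (V : vectType K) (L : 'End(V)) (v : V) :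
  (lker L <= <[v]>)%VS -> v \notin limg L -> (limg L + <[v]> = fullv)%VS.
Proof.
move=> ker_line v_limg; apply/eqP; rewrite eqEdim subvf /=.
rewrite dimv_disjoint_sum; last first.
  apply/eqP; rewrite -subv0; apply/subvP => w; rewrite memv_cap.
  case/andP=> + /vlineP[a wE]; rewrite {}wE rpredZeq (negbTE v_limg) orbF.
  by move/eqP->; rewrite scale0r mem0v.
have := limg_ker_dim L fullv; rewrite capfv => <-.
by rewrite addnC leq_add2l dimvS.
Qed.

Section GeometricSums.
Variables (R : comNzRingType) (T : Type) (t : R).
Implicit Types (g : T -> R) (s : seq T).

Definition geom_sum g s : R := foldr (fun q acc => g q + t * acc) 0 s.

Lemma geom_sumE g x0 s :
  geom_sum g s = \sum_(i < size s) t ^+ i * g (nth x0 s i).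
Proof.
elim: s => [|q s IHs] /=; first by rewrite big_ord0.
rewrite big_ord_recl /= expr0 mul1r IHs mulr_sumr; congr (_ + _).
by apply: eq_bigr => i _; rewrite mulrA -exprS.
Qed.

Lemma geom_sum_rcons g s q :
  geom_sum g (rcons s q) = geom_sum g s + t ^+ size s * g q.
Proof.
elim: s => [|p s IHs] /=; first by rewrite expr0; ring.
by rewrite IHs exprS; ring.
Qed.

End GeometricSums.

Lemma eq_in_geom_sum (R : comNzRingType) (T : eqType) (t : R) (g1 g2 : T -> R)
    (s : seq T) :
  {in s, g1 =1 g2} -> geom_sum t g1 s = geom_sum t g2 s.
Proof.
elim: s => //= q s IHs e; rewrite e ?mem_head // IHs // => p ps.
by apply: e; rewrite inE ps orbT.
Qed.

Section Pointwise.
Variables (R : comNzRingType) (C : finType).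
Local Notation fn := {ffun C -> R^o}.
Implicit Types (f g : fn) (a : R) (z : C).

Lemma fn_addE f g z : (f + g) z = f z + g z.
Proof. by rewrite ffunE. Qed.

Lemma fn_oppE f z : (- f) z = - f z.
Proof. by rewrite ffunE. Qed.

Lemma fn_scaleE a f z : (a *: f) z = a * f z.
Proof. by rewrite ffunE. Qed.

Definition const_fn a : fn := [ffun=> a].

Lemma const_fnE a z : const_fn a z = a.
Proof. by rewrite ffunE. Qed.

Definition fn_opE := (fn_addE, fn_oppE, fn_scaleE, const_fnE).

Definition kernel_op (K : C -> C -> R) f : fn :=
  [ffun z => \sum_w K z w * f w].

Lemma kernel_opE K f z : kernel_op K f z = \sum_w K z w * f w.
Proof. by rewrite ffunE. Qed.

Lemma kernel_op_linear K : linear (kernel_op K).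
Proof.
move=> a f g; apply/ffunP => z; rewrite !(fn_opE, kernel_opE) mulr_sumr.
by rewrite -big_split; apply: eq_bigr => w _; rewrite !fn_opE /=; ring.
Qed.

HB.instance Definition _ K :=
  GRing.isLinear.Build R fn fn _ _ (@kernel_op_linear K).

End Pointwise.

Section MarkovGenerator.
Variables (R : realFieldType) (C J : finType).
Local Notation fn := {ffun C -> R^o}.
Local Notation const := (@const_fn R C).
Variable B : J -> {linear fn -> fn}.
Implicit Types (f g h : fn) (z w : C) (j : J) (r : J -> R).

Definition rate_gen r f : fn := \sum_j r j *: (B j f - f).

Lemma rate_genE r f z : rate_gen r f z = \sum_j r j * (B j f z - f z).
Proof. by rewrite sum_ffunE; apply: eq_bigr => j _; rewrite !fn_opE. Qed.

Lemma rate_gen_linear r : linear (rate_gen r).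
Proof.
move=> a f g; apply/ffunP => z; rewrite !(fn_opE, rate_genE) mulr_sumr.
by rewrite -big_split; apply: eq_bigr => j _; rewrite linearP !fn_opE /=; ring.
Qed.

HB.instance Definition _ r :=
  GRing.isLinear.Build R fn fn _ _ (@rate_gen_linear r).

Lemma fn_argmax f z0 : exists z, forall w, f w <= f z.
Proof.
have [z _ z_max] := arg_maxP f (erefl true : predT z0).
by exists z => w; apply: z_max.
Qed.

Hypothesis B_ge0 : forall j f, (forall z, 0 <= f z) -> forall z, 0 <= B j f z.
Hypothesis B_const : forall j a, B j (const a) = const a.

Lemma markov_le j f a z : (forall w, f w <= a) -> B j f z <= a.
Proof.
move=> f_le; have := @B_ge0 j (const a - f) _ z.
rewrite linearB /= B_const !fn_opE subr_ge0; apply => w.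
by rewrite !fn_opE subr_ge0.
Qed.

Section PositiveRates.
Variable r : J -> R.
Hypothesis r_gt0 : forall j, 0 < r j.

Lemma rate_gen_max_le0 f z : (forall w, f w <= f z) -> rate_gen r f z <= 0.
Proof.
move=> z_max; rewrite rate_genE; apply: sumr_le0 => j _.
by rewrite pmulr_rle0 // subr_le0 markov_le.
Qed.

Lemma harmonic_max f z j : rate_gen r f = 0 ->
  (forall w, f w <= f z) -> B j f z = f z.
Proof.
move=> harm z_max; have := rate_genE r f z; rewrite harm [LHS]ffunE.
move/esym/eqP; rewrite -oppr_eq0 -sumrN psumr_eq0 => [/allP/(_ j)|i _].
  rewrite mem_index_enum => /(_ isT).
  by rewrite oppr_eq0 mulf_eq0 gt_eqF //= subr_eq0 => /eqP.
by rewrite oppr_ge0 pmulr_rle0 // subr_le0 markov_le.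
Qed.

(* Solvability of the Poisson equation: modulo the range of the generator, f  *)
(* is the constant a, so that every invariant mean of f equals a.             *)
Definition poisson_mean f a := exists g, f = rate_gen r g + const a.

Lemma poisson_mean_le f a b z0 :
  poisson_mean f a -> poisson_mean f b -> a <= b.
Proof.
move=> [g ->] [h gh]; rewrite -subr_le0.
have [z /rate_gen_max_le0] := fn_argmax (h - g) z0; congr (_ <= 0).
by have /ffunP/(_ z) := gh; rewrite linearB /= !fn_opE => e; lra.
Qed.

Lemma poisson_mean_unique f a b z0 :
  poisson_mean f a -> poisson_mean f b -> a = b.
Proof.
by move=> fa fb; apply/le_anti; rewrite !(poisson_mean_le (f := f) z0).
Qed.

(* The state step j z has positive weight in B j at z, so that the states     *)
(* where a harmonic function is maximal are closed under step.                *)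
Variables (step : J -> C -> C) (word : seq J).
Hypothesis step_zero : forall j h z, (forall w, 0 <= h w) ->
  B j h z = 0 -> h (step j z) = 0.
Local Notation walk z := (foldl (fun w j => step j w) z word).
Hypothesis walk_merge : forall z w, walk z = walk w.

Lemma harmonic_max_walk f z : rate_gen r f = 0 ->
  (forall w, f w <= f z) -> f (walk z) = f z.
Proof.
move=> harm; elim: word z => //= j l IHl z z_max.
have step_max : f (step j z) = f z.
  have := @step_zero j (const (f z) - f) z.
  rewrite linearB /= B_const !fn_opE harmonic_max // subrr => e.
  by apply/esym/subr0_eq/e => // w; rewrite !fn_opE subr_ge0.
by rewrite IHl step_max.
Qed.

Lemma harmonic_const f z0 : rate_gen r f = 0 -> f = const (f z0).
Proof.
move=> harm; have [z f_le] := fn_argmax f z0.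
have [w f_ge] := fn_argmax (- f) z0.
have harmN : rate_gen r (- f) = 0 by rewrite linearN /= harm oppr0.
have e : f w = f z.
  apply: oppr_inj; rewrite -fn_oppE -(harmonic_max_walk harmN f_ge).
  by rewrite (walk_merge w z) fn_oppE (harmonic_max_walk harm f_le).
have f_eq v : f v = f z.
  by apply/le_anti; rewrite f_le -e -lerN2 -!fn_oppE f_ge.
by apply/ffunP => v; rewrite const_fnE !f_eq.
Qed.

Lemma poisson_mean_exists f z0 : exists a, poisson_mean f a.
Proof.
pose L : 'End(fn) := linfun (rate_gen r).
have scale1 a : a *: const 1 = const a.
  by apply/ffunP => z; rewrite !fn_opE mulr1.
have ker_const : (lker L <= <[const 1]>)%VS.
  apply/subvP => g; rewrite memv_ker lfunE => /eqP/(harmonic_const z0) ->.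
  by apply/vlineP; exists (g z0); rewrite scale1.
have const_limg : const 1 \notin limg L.
  apply/negP => /memv_imgP[g _]; rewrite lfunE => e.
  have mean1 : poisson_mean (const 1) 1 by exists 0; rewrite linear0 add0r.
  have mean0 : poisson_mean (const 1) 0.
    by exists g; rewrite e; apply/ffunP => z; rewrite !fn_opE addr0.
  by have/eqP := poisson_mean_unique z0 mean1 mean0; rewrite oner_eq0.
have := memvf f; rewrite -(limg_addv_line ker_const const_limg).
case/memv_addP => _ /memv_imgP[g _ ->] [_ /vlineP[a ->] ->].
by exists a, g; rewrite lfunE scale1.
Qed.

End PositiveRates.
End MarkovGenerator.

Section Laps.
Local Open Scope nat_scope.
Variable n : nat.
Implicit Types i j p : 'I_n.

Lemma val_iter_ordS m j : iter m (@ordS n) j = (j + m) %% n :> nat.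
Proof.
elim: m => [|m IHm]; first by rewrite addn0 modn_small.
by rewrite iterS /= IHm -addn1 modnDml addn1 addnS.
Qed.

Lemma iter_ordS_n j : iter n (@ordS n) j = j.
Proof. by apply: val_inj; rewrite /= val_iter_ordS modnDr modn_small. Qed.

Definition lap j : seq 'I_n := traject (@ordS n) (ordS j) n.

Lemma nth_lap j i : nth j (lap j) ((i + (n - j.+1)) %% n) = i.
Proof.
have n_gt0 : 0 < n by apply: leq_ltn_trans (ltn_ord i).
rewrite (set_nth_default (ordS j)) ?size_traject ?ltn_pmod //.
rewrite nth_traject ?ltn_pmod // -iterSr; apply: val_inj.
rewrite [LHS]val_iter_ordS -addSnnS modnDmr addnCA subnKC //.
by rewrite modnDr modn_small.
Qed.

Lemma mem_lap i j : i \in lap j.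
Proof.
rewrite -[i in i \in _](nth_lap j) mem_nth // size_traject ltn_pmod //.
exact: leq_ltn_trans (ltn_ord i).
Qed.

Lemma lap_uniq j : uniq (lap j).
Proof.
apply/card_uniqP; rewrite size_traject.
by rewrite (eq_card (B := 'I_n)) ?card_ord // => i; apply: mem_lap.
Qed.

Lemma index_lap j i :
  index i (lap j) = if j < i then i - j.+1 else i + (n - j.+1).
Proof.
have -> : index i (lap j) = (i + (n - j.+1)) %% n.
  rewrite -[i in LHS](nth_lap j) index_uniq ?lap_uniq // size_traject.
  exact/ltn_pmod/leq_ltn_trans/ltn_ord.
have [i_n j_n] := (ltn_ord i, ltn_ord j).
case: ltnP => ij; last by rewrite modn_small //; lia.
have -> : i + (n - j.+1) = i - j.+1 + n by lia.
by rewrite modnDr modn_small //; lia.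
Qed.

Lemma last_lap j : last j (lap j) = j.
Proof. by rewrite last_traject iter_ordS_n. Qed.

Lemma lap_shift p :
  exists l, lap p = ordS p :: l /\ lap (ordS p) = rcons l (ordS p).
Proof.
have := iter_ordS_n (ordS p); rewrite /lap.
case: (n) p => [|n'] p; first by case: p.
move=> e; exists (traject (@ordS n'.+1) (ordS (ordS p)) n').
by rewrite (trajectSr _ (ordS (ordS p))) -iterSr e.
Qed.

Lemma lap_shift_neq i : i != ordS i ->
  exists l, [/\ lap i = ordS i :: rcons l i,
    lap (ordS i) = rcons (rcons l i) (ordS i), i \notin l & ordS i \notin l].
Proof.
move=> iS; have [l [li lS]] := lap_shift i.
have := lap_uniq i; have := last_lap i; rewrite li lS.
case/lastP: l {li lS} => [/= e|l q]; first by rewrite e eqxx in iS.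
rewrite /= last_rcons => -> /andP[].
rewrite mem_rcons inE negb_or rcons_uniq => /andP[_ Sl] /andP[il _].
by exists l.
Qed.

Lemma lap_split_adjacent i j : j != i -> j != ordS i ->
  exists l1 l2, [/\ lap j = l1 ++ [:: i, ordS i & l2],
    i \notin l1 ++ l2 & ordS i \notin l1 ++ l2].
Proof.
move=> ji jS; have := last_lap j; have := lap_uniq j; have := mem_lap i j.
have : fpath (@ordS n) j (lap j) by rewrite fpath_traject.
move=> fp il; case/splitPr: il fp => l1 [|q l2].
  by rewrite last_cat /= => _ _ ij; rewrite ij eqxx in ji.
rewrite cat_path /= => /and4P[_ _ /eqP <- _] + _.
rewrite cat_uniq /= !inE !negb_or.
move=> /and3P[_ /and3P[il1 Sl1 _] /and3P[/andP[_ il2] Sl2 _]].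
by exists l1, l2; rewrite !mem_cat !negb_or il1 Sl1 il2 Sl2.
Qed.

End Laps.

Section Relabeling.
Variables (n : nat) (lam : n.-tuple nat).
Local Notation C := (config lam).
Implicit Types (eta : C) (i j k u v : 'I_n) (s : {perm 'I_n}).

Definition permute_sites (c : {ffun 'I_n -> nat}) s : {ffun 'I_n -> nat} :=
  [ffun k => c (s k)].

Lemma permute_sitesP s eta : perm_eq (codom (permute_sites eta s)) lam.
Proof.
apply: perm_trans (configP eta); rewrite !codomE.
rewrite (eq_map (g := eta \o s)) => [|k]; last by rewrite ffunE.
rewrite map_comp; apply/perm_map/uniq_perm; rewrite ?enum_uniq //.
  by rewrite (map_inj_uniq perm_inj) enum_uniq.
move=> k; rewrite mem_enum; apply/mapP.
by exists (s^-1%g k); rewrite ?mem_enum ?permKV.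
Qed.

Definition permute s eta : C := Config (permute_sitesP s eta).

Lemma permuteE s eta k : permute s eta k = eta (s k).
Proof. by rewrite /= ffunE. Qed.

Lemma config_eqP eta (zeta : C) : (forall k, eta k = zeta k) -> eta = zeta.
Proof. by move=> e; apply/val_inj/ffunP. Qed.

Lemma permuteM s s' eta : permute s (permute s' eta) = permute (s * s')%g eta.
Proof. by apply: config_eqP => k; rewrite !permuteE permM. Qed.

Lemma permute1 eta : permute 1%g eta = eta.
Proof. by apply: config_eqP => k; rewrite permuteE perm1. Qed.

Local Notation swap i j := (permute (tperm i j)).

Lemma swapK i j : involutive (swap i j).
Proof. by move=> eta; rewrite permuteM tperm2 permute1. Qed.

Lemma swap_id i j eta : eta i = eta j -> swap i j eta = eta.
Proof.
by move=> e; apply: config_eqP => k; rewrite permuteE; case: tpermP => [->|->|].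
Qed.

Lemma permute_swap s i j eta :
  permute s (swap (s i) (s j) eta) = swap i j (permute s eta).
Proof.
rewrite !permuteM -tpermJ; congr (permute _ eta).
by rewrite conjgE mulgA mulgA mulgV mul1g.
Qed.

Lemma swap_conj i k u v eta :
  swap i k (swap u v eta) =
  swap (tperm i k u) (tperm i k v) (swap i k eta).
Proof. by rewrite -[RHS]permute_swap !tpermK. Qed.

End Relabeling.

Notation swap i j := (permute (tperm i j)).

Section ScatteringOperators.
Variables (R : comNzRingType) (n : nat) (lam : n.-tuple nat) (t : R).
Local Notation C := (config lam).
Local Notation fn := {ffun C -> R^o}.
Implicit Types (f g : fn) (eta : C) (i j k u v : 'I_n) (l : seq 'I_n).
Implicit Type s : {perm 'I_n}.

Definition permute_fn s f : fn := [ffun eta => f (permute s eta)].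

Lemma permute_fnE s f eta : permute_fn s f eta = f (permute s eta).
Proof. by rewrite ffunE. Qed.

Lemma permute_fn_linear s : linear (permute_fn s).
Proof. by move=> a f g; apply/ffunP => eta; rewrite !ffunE. Qed.

HB.instance Definition _ s :=
  GRing.isLinear.Build R fn fn _ _ (@permute_fn_linear s).

(* The particle stored at j meets site k: if k is weaker, it settles there    *)
(* with probability 1 - t, after which the displaced particle is stored at j. *)
Definition scatter j k f : fn :=
  [ffun eta : C => if (eta k < eta j)%N
                   then (1 - t) * f (swap j k eta) + t * f eta else f eta].

Lemma scatterE j k f eta : scatter j k f eta =
  if (eta k < eta j)%N then (1 - t) * f (swap j k eta) + t * f eta else f eta.
Proof. by rewrite ffunE. Qed.

Lemma scatter_linear j k : linear (scatter j k).
Proof.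
move=> a f g; apply/ffunP => eta; rewrite !(scatterE, fn_opE).
by case: ifP => _; [ring|].
Qed.

HB.instance Definition _ j k :=
  GRing.isLinear.Build R fn fn _ _ (@scatter_linear j k).

Definition sweep j l f : fn := foldr (scatter j) f l.

Lemma sweep_linear j l : linear (sweep j l).
Proof. by move=> a f g; elim: l => //= k l ->; rewrite scatter_linear. Qed.

HB.instance Definition _ j l :=
  GRing.isLinear.Build R fn fn _ _ (@sweep_linear j l).

Lemma sweep_cat j l1 l2 f : sweep j (l1 ++ l2) f = sweep j l1 (sweep j l2 f).
Proof. exact: foldr_cat. Qed.

Lemma sweep_rcons j l k f : sweep j (rcons l k) f = sweep j l (scatter j k f).
Proof. exact: foldr_rcons. Qed.

Definition hecke i k f : fn := scatter i k (permute_fn (tperm i k) f).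

Lemma hecke_linear i k : linear (hecke i k).
Proof. by move=> a f g; rewrite /hecke permute_fn_linear scatter_linear. Qed.

HB.instance Definition _ i k :=
  GRing.isLinear.Build R fn fn _ _ (@hecke_linear i k).

Lemma scatter_refl j f : scatter j j f = f.
Proof. by apply/ffunP => eta; rewrite scatterE ltnn. Qed.

Lemma permute_fn_tpermK i k : involutive (permute_fn (tperm i k)).
Proof. by move=> f; apply/ffunP => eta; rewrite !permute_fnE swapK. Qed.

Lemma permute_fn_scatter s j k f :
  permute_fn s (scatter j k f) = scatter (s j) (s k) (permute_fn s f).
Proof.
apply/ffunP => eta; rewrite !(scatterE, permute_fnE) !permuteE.
by rewrite permute_swap.
Qed.

Lemma permute_fn_sweep s j l f :
  permute_fn s (sweep j l f) = sweep (s j) (map s l) (permute_fn s f).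
Proof. by elim: l => //= k l IHl; rewrite permute_fn_scatter IHl. Qed.

Lemma scatter_far i k u v f : u != i -> u != k -> v != i -> v != k ->
  scatter i k (scatter u v f) = scatter u v (scatter i k f).
Proof.
move=> ui uk vi vk; apply/ffunP => eta; rewrite !scatterE !permuteE.
rewrite !tpermD // 1?eq_sym //.
have -> : swap i k (swap u v eta) = swap u v (swap i k eta).
  by rewrite swap_conj !tpermD // eq_sym.
by do 2![case: ifP => // _]; ring.
Qed.

Lemma yang_baxter j i k f : j != i -> j != k -> i != k ->
  scatter j i (scatter j k (scatter i k f)) =
  scatter i k (scatter j k (scatter j i f)).
Proof.
move=> ji jk ik; apply/ffunP => eta.
have tji_k : tperm j i k = k by rewrite tpermD.
have tjk_i : tperm j k i = i by rewrite tpermD // eq_sym.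
have tik_j : tperm i k j = j by rewrite tpermD // eq_sym.
have swap_ik_ji c : swap i k (swap j i c) = swap j i (swap j k c).
  by rewrite [RHS]swap_conj tpermL tji_k.
have swap_jk_ik c : swap j k (swap i k c) = swap j i (swap j k c).
  by rewrite swap_conj tpermR tjk_i tpermC.
have swap_jk_ji c : swap j k (swap j i c) = swap j i (swap i k c).
  by rewrite [RHS]swap_conj tpermR tji_k.
have swap_ik_jk c : swap i k (swap j k c) = swap j i (swap i k c).
  by rewrite swap_conj tpermR tik_j.
rewrite !scatterE !permuteE !(tpermL, tpermR, tji_k, tjk_i, tik_j).
rewrite !(swap_ik_ji, swap_jk_ik, swap_jk_ji, swap_ik_jk, swapK).
case: (ltngtP (eta i) (eta j)) => eij; case: (ltngtP (eta k) (eta j)) => ekj;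
  case: (ltngtP (eta k) (eta i)) => eki; try lia; try ring.
- by rewrite -swap_jk_ik (swap_id (esym eki)); ring.
- by rewrite -swap_jk_ji (swap_id (esym eij)); ring.
Qed.

Lemma hecke_scatter_far i k u v f : u != i -> u != k -> v != i -> v != k ->
  hecke i k (scatter u v f) = scatter u v (hecke i k f).
Proof.
move=> ui uk vi vk; rewrite /hecke permute_fn_scatter.
by rewrite !tpermD 1?eq_sym // scatter_far.
Qed.

Lemma hecke_scatter_braid i k j f : j != i -> j != k -> i != k ->
  hecke i k (scatter j i (scatter j k f)) =
  scatter j i (scatter j k (hecke i k f)).
Proof.
move=> ji jk ik; rewrite /hecke yang_baxter // !permute_fn_scatter.
by rewrite tpermL tpermR tpermD // eq_sym.
Qed.

Lemma hecke_quadratic i k f :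
  hecke i k (hecke i k f) = (1 - t) *: hecke i k f + t *: f.
Proof.
apply/ffunP => eta; rewrite !(fn_opE, scatterE, permute_fnE) !permuteE.
rewrite !(tpermL, tpermR) !swapK.
case: (ltngtP (eta k) (eta i)) => eki; try ring.
by rewrite (swap_id (esym eki)); ring.
Qed.

(* By the quadratic relation, this is t times the inverse of hecke i k. *)
Definition hecke_dual i k f : fn := hecke i k f - (1 - t) *: f.

Lemma hecke_hecke_dual i k f : hecke i k (hecke_dual i k f) = t *: f.
Proof. by rewrite linearB linearZ /= hecke_quadratic addrAC subrr add0r. Qed.

Lemma hecke_dual_hecke i k f : hecke_dual i k (hecke i k f) = t *: f.
Proof. by rewrite /hecke_dual hecke_quadratic addrAC subrr add0r. Qed.

Lemma hecke_dual_scatter i k f :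
  hecke_dual i k (scatter i k f) = t *: permute_fn (tperm i k) f.
Proof.
by rewrite -(hecke_dual_hecke i k (permute_fn _ f)) /hecke permute_fn_tpermK.
Qed.

Lemma hecke_permute i k f :
  hecke i k f = permute_fn (tperm i k) (scatter k i f).
Proof. by rewrite permute_fn_scatter tpermL tpermR. Qed.

Lemma scatter_hecke_dual i k f :
  scatter k i (hecke_dual i k f) = t *: permute_fn (tperm i k) f.
Proof.
apply: (inv_inj (permute_fn_tpermK i k)).
by rewrite -hecke_permute hecke_hecke_dual linearZ /= permute_fn_tpermK.
Qed.

Lemma sweep_hecke_far i k j l f :
  j != i -> j != k -> i \notin l -> k \notin l ->
  sweep j l (hecke i k f) = hecke i k (sweep j l f).
Proof.
move=> ji jk; elim: l => //= q l IHl.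
rewrite !inE !negb_or => /andP[iq il] /andP[kq kl].
by rewrite IHl // hecke_scatter_far // eq_sym.
Qed.

Lemma sweep_permute_fn i k l f : i \notin l -> k \notin l ->
  sweep i l (permute_fn (tperm i k) f) = permute_fn (tperm i k) (sweep k l f).
Proof.
move=> il kl; rewrite permute_fn_sweep tpermR map_id_in // => q ql.
by rewrite tpermD //; [apply: contraNneq il|apply: contraNneq kl] => ->.
Qed.

Lemma lap_hecke_far i j f : i != ordS i -> j != i -> j != ordS i ->
  sweep j (lap j) (hecke i (ordS i) f) = hecke i (ordS i) (sweep j (lap j) f).
Proof.
move=> iS ji jS; have [l1 [l2 [-> ]]] := lap_split_adjacent ji jS.
rewrite !mem_cat !negb_or => /andP[il1 il2] /andP[Sl1 Sl2].
rewrite !sweep_cat /= sweep_hecke_far // -hecke_scatter_braid //.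
by rewrite sweep_hecke_far.
Qed.

Lemma lap_hecke i f : i != ordS i ->
  sweep i (lap i) (hecke i (ordS i) f) =
  hecke i (ordS i) (sweep (ordS i) (lap (ordS i)) f).
Proof.
move=> iS; have [l [-> -> il Sl]] := lap_shift_neq iS.
rewrite /= !sweep_rcons !scatter_refl hecke_permute.
by rewrite sweep_permute_fn.
Qed.

Lemma lap_hecke_dual i f : i != ordS i ->
  sweep (ordS i) (lap (ordS i)) (hecke_dual i (ordS i) f) =
  hecke_dual i (ordS i) (sweep i (lap i) f).
Proof.
move=> iS; have [l [-> -> il Sl]] := lap_shift_neq iS.
rewrite /= !sweep_rcons !scatter_refl hecke_dual_scatter scatter_hecke_dual.
by rewrite linearZ /= tpermC sweep_permute_fn.
Qed.

End ScatteringOperators.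

Section Relay.
Variables (R : realType) (n : nat) (t : R).
Implicit Types (c eta cur zeta : {ffun 'I_n -> nat}) (i j k p q : 'I_n).

Lemma set_site_id c j : set_site c j (c j) = c.
Proof. by apply/ffunP => i; rewrite ffunE; case: eqP => // ->. Qed.

Definition weaker j p c : seq 'I_n := [seq i <- lap p | (c i < c j)%N].

(* The cascade seen as a single particle whose species is stored at the bell  *)
(* site j: settling at q exchanges the contents of j and q, and p is only the *)
(* place where the next search starts.                                        *)
Fixpoint relay (fuel : nat) j p c zeta : R :=
  if fuel is fuel'.+1 then
    if c j == 0%N then (c == zeta)%:R
    else (qint t (size (weaker j p c)))^-1 *
      geom_sum t (fun q => relay fuel' j q (permute_sites c (tperm j q)) zeta)
        (weaker j p c)
  else 0.

(* An invariant of the cascade started by the bell at j, when the particle of *)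
(* species eta p has just been removed from p.                                *)
Definition mid_cascade eta j p cur : Prop :=
  [/\ cur j = 0%N,
    forall q, (eta q < eta p)%N -> q != j /\ cur q = eta q
  & forall q, q != j -> (eta p <= eta q)%N -> (eta p <= cur q)%N].

Lemma mid_cascade_start eta j : mid_cascade eta j j (set_site eta j 0).
Proof.
split=> [|q qj|q qj]; rewrite ffunE; first by rewrite eqxx.
  have q_neq_j : q != j by apply: contraTneq qj => ->; rewrite ltnn.
  by rewrite (negbTE q_neq_j).
by rewrite (negbTE qj).
Qed.

Lemma mid_cascade_settle eta j p q cur :
  mid_cascade eta j p cur -> (eta q < eta p)%N ->
  mid_cascade eta j q (set_site cur q (eta p)).
Proof.
move=> [cur_j low high] qp; have [q_neq_j _] := low _ qp.
split=> [|i iq|i i_neq_j qi]; rewrite ffunE.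
- by rewrite eq_sym (negbTE q_neq_j).
- have [i_neq_j cur_i] := low _ (ltn_trans iq qp).
  by split=> //; case: eqP iq => // ->; rewrite ltnn.
- case: eqP => _; first exact: ltnW.
  have [/low[_ ->] //|/(high _ i_neq_j)] := ltnP (eta i) (eta p).
  exact/leq_trans/ltnW.
Qed.

Lemma weaker_mid_cascade eta j p cur : mid_cascade eta j p cur ->
  weaker j p (set_site cur j (eta p)) = weaker_sites eta p.
Proof.
move=> [_ low high]; apply: eq_in_filter => q _; rewrite !ffunE eqxx.
have [->|q_neq_j] := eqVneq q j.
  by rewrite ltnn; apply/esym/negP => /low[/eqP].
have [/low[_ ->] //|pq] := ltnP (eta q) (eta p).
by rewrite ltnNge (high _ q_neq_j pq).
Qed.

Lemma cascade_relay fuel eta j p cur zeta : mid_cascade eta j p cur ->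
  cascade_prob t fuel eta p cur zeta =
  relay fuel j p (set_site cur j (eta p)) zeta.
Proof.
elim: fuel p cur => //= fuel IHfuel p cur mid.
have [cur_j low _] := mid.
rewrite weaker_mid_cascade // ffunE eqxx; case: eqP => [p0|/eqP p0].
  by rewrite p0 -cur_j set_site_id.
rewrite (geom_sumE _ _ p) mulr_sumr; apply: eq_bigr => i _.
rewrite mulrCA -mulrA; congr (_ * (_ * _)).
set q := nth _ _ _; have : q \in weaker_sites eta p by apply: mem_nth.
rewrite mem_filter => /andP[qp _]; have [q_neq_j cur_q] := low _ qp.
rewrite IHfuel; last exact: mid_cascade_settle.
congr relay; apply/ffunP => k; rewrite !ffunE !permE /=.
have [_|k_neq_j] := eqVneq k j; first by rewrite (negbTE q_neq_j) cur_q.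
by have [_|_] := eqVneq k q; rewrite ?eqxx // (negbTE k_neq_j).
Qed.

Lemma bell_prob_relay j eta zeta :
  bell_prob t j eta zeta = relay (eta j).+1 j j eta zeta.
Proof.
rewrite /bell_prob (cascade_relay _ _ (mid_cascade_start eta j)).
by congr relay; apply/ffunP => i; rewrite !ffunE; case: eqP => // ->.
Qed.

Lemma relay_fuel fuel1 fuel2 j p c zeta :
  (c j < fuel1)%N -> (c j < fuel2)%N ->
  relay fuel1 j p c zeta = relay fuel2 j p c zeta.
Proof.
elim: fuel1 fuel2 p c => [|m1 IH] [|m2] p c //= c_m1 c_m2; case: ifP => // _.
congr (_ * _); apply: eq_in_geom_sum => q; rewrite mem_filter => /andP[qj _].
by apply: IH; rewrite ffunE tpermL; apply: leq_trans qj _; rewrite -ltnS.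
Qed.

Hypotheses (t_ge0 : 0 <= t) (t_lt1 : t < 1).

Lemma mul_qint m : (1 - t) * qint t m = 1 - t ^+ m.
Proof. by rewrite -[RHS]opprB subrX1 -mulNr opprB. Qed.

Lemma qint_gt0 m : (0 < m)%N -> 0 < qint t m.
Proof.
move=> m_gt0; rewrite -(pmulr_rgt0 _ (_ : 0 < 1 - t)) ?subr_gt0 // mul_qint.
by rewrite subr_gt0 exprn_ilt1 // -lt0n.
Qed.

Lemma qint_ge0 m : 0 <= qint t m.
Proof. by apply: sumr_ge0 => i _; apply: exprn_ge0. Qed.

Lemma cascade_prob_ge0 fuel eta p cur zeta :
  0 <= cascade_prob t fuel eta p cur zeta.
Proof.
elim: fuel p cur => //= fuel IH p cur; case: ifP => // _.
by apply: sumr_ge0 => i _; rewrite mulr_ge0 // divr_ge0 ?exprn_ge0 ?qint_ge0.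
Qed.

(* Skipping one weaker site costs a factor t; since the search is cyclic,     *)
(* this one-site recursion encodes the whole geometric choice.                *)
Lemma relay_step j p c zeta (q := ordS p) (c' := permute_sites c (tperm j q)) :
  relay (c j).+1 j p c zeta =
  if (c q < c j)%N then
    (1 - t) * relay (c' j).+1 j q c' zeta + t * relay (c j).+1 j q c zeta
  else relay (c j).+1 j q c zeta.
Proof.
have [l [lp lq]] := lap_shift p; have c'j : c' j = c q by rewrite ffunE tpermL.
rewrite c'j; set g := relay (c q).+1 _ _ _ _.
rewrite [relay (c j).+1 _ _ _ _]/= [relay (c j).+1 _ q _ _]/=.
case: ifP => [/eqP ->|/eqP/eqP cj0] //.
rewrite /weaker lp lq filter_rcons /= -/q; case: ifP => // qj.
rewrite size_rcons geom_sum_rcons /=; set m := size _; set G := geom_sum _ _ _.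
rewrite (relay_fuel _ _ (fuel2 := (c q).+1)) ?c'j // -/c' -/g.
have := mul_qint m.+1; have := qint_gt0 (isT : (0 < m.+1)%N).
set Q := qint _ _; rewrite exprS => Q_gt0 mulQ.
have tm : t * t ^+ m = 1 - (1 - t) * Q by rewrite mulQ; ring.
have -> : t * (Q^-1 * (G + t ^+ m * g)) = Q^-1 * (t * G + t * t ^+ m * g).
  by ring.
by rewrite tm; field; rewrite gt_eqF.
Qed.

End Relay.

Section Bell.
Variables (R : realType) (n : nat) (lam : n.-tuple nat) (t : R).
Local Notation C := (config lam).
Local Notation fn := {ffun C -> R^o}.
Local Notation const := (@const_fn R C).
Implicit Types (f g h : fn) (eta zeta : C) (i j k p : 'I_n).

Definition bell_op j : fn -> fn :=
  kernel_op (fun eta zeta : C => bell_prob t j eta zeta).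

HB.instance Definition _ j := GRing.Linear.on (bell_op j).

Lemma bell_opE j f eta :
  bell_op j f eta = \sum_zeta bell_prob t j eta (zeta : C) * f zeta.
Proof. exact: kernel_opE. Qed.

Lemma bell_prob_vacant j eta zeta :
  eta j = 0%N -> bell_prob t j eta zeta = (eta == zeta)%:R.
Proof.
move=> eta0; rewrite /bell_prob /= eta0 /=.
by rewrite -[in set_site _ _ _]eta0 set_site_id.
Qed.

Lemma bell_op_vacant j f eta : eta j = 0%N -> bell_op j f eta = f eta.
Proof.
move=> eta0; rewrite bell_opE (bigD1 eta) //= big1 => [|zeta neq].
  by rewrite addr0 bell_prob_vacant // eqxx mul1r.
by rewrite bell_prob_vacant // eq_sym (negbTE neq) mul0r.
Qed.

Hypotheses (t_ge0 : 0 <= t) (t_lt1 : t < 1).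

Lemma bell_op_ge0 j f :
  (forall zeta, 0 <= f zeta) -> forall eta, 0 <= bell_op j f eta.
Proof.
move=> f_ge0 eta; rewrite bell_opE sumr_ge0 // => zeta _.
by rewrite mulr_ge0 // cascade_prob_ge0.
Qed.

Definition relay_op j p : fn -> fn :=
  kernel_op (fun eta zeta : C => relay t (eta j).+1 j p eta zeta).

Lemma relay_op_step j p f :
  relay_op j p f = scatter t j (ordS p) (relay_op j (ordS p) f).
Proof.
apply/ffunP => eta; rewrite scatterE !kernel_opE.
under eq_bigr do rewrite relay_step //.
case: ifP => // _; rewrite !mulr_sumr -big_split; apply: eq_bigr => zeta _ /=.
by ring.
Qed.

Lemma sweep_relay_op m j p f :
  sweep t j (traject (@ordS n) (ordS p) m)
    (relay_op j (iter m (@ordS n) p) f) = relay_op j p f.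
Proof.
by elim: m p => //= m IHm p; rewrite -iterS iterSr IHm -relay_op_step.
Qed.

Lemma lap_bell_op j f : sweep t j (lap j) (bell_op j f) = bell_op j f.
Proof.
have -> : bell_op j f = relay_op j j f.
  apply/ffunP => eta; rewrite bell_opE kernel_opE.
  by apply: eq_bigr => zeta _; rewrite bell_prob_relay.
by rewrite -[RHS](sweep_relay_op n) iter_ordS_n.
Qed.

Lemma sweep_vanish_below j h r l eta :
  (forall zeta, (zeta j < r)%N -> h zeta = 0) -> (eta j < r)%N ->
  sweep t j l h eta = 0.
Proof.
move=> h0; elim: l eta => [|k l IHl] eta eta_r /=; first exact: h0.
rewrite scatterE (IHl eta) // mulr0 addr0; case: ifP => // kj.
by rewrite IHl ?mulr0 // permuteE tpermL (ltn_trans kj).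
Qed.

Lemma sweep_leading j h l eta :
  (forall zeta, (zeta j < eta j)%N -> h zeta = 0) ->
  sweep t j l h eta = t ^+ count (fun k => eta k < eta j)%N l * h eta.
Proof.
move=> h0; elim: l => [|k l IHl] /=; first by rewrite expr0 mul1r.
rewrite scatterE IHl; case: ifP => // kj.
rewrite (sweep_vanish_below _ h0) ?permuteE ?tpermL // mulr0 add0r.
by rewrite add1n exprS mulrA.
Qed.

Hypothesis lam_vacancy : 0%N \in lam.

Lemma vacancy eta : exists k, eta k = 0%N.
Proof.
have : 0%N \in codom eta by rewrite (perm_mem (configP eta)).
by case/codomP => k ->; exists k.
Qed.

(* Without vacancy at j a lap either lowers the species stored at j or costs  *)
(* a factor t ^+ m with m > 0, so a fixed point of the lap is determined by   *)
(* its values on the configurations vacant at j.                              *)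
Lemma lap_fixed_eq0 j h : sweep t j (lap j) h = h ->
  (forall eta, eta j = 0%N -> h eta = 0) -> h = 0.
Proof.
move=> h_fixed h_vacant; apply/ffunP => eta; rewrite [RHS]ffunE.
have [r] := ubnP (eta j); elim: r eta => // r IHr eta; rewrite ltnS => eta_r.
have [eta0|eta_gt0] := posnP (eta j); first exact: h_vacant.
have := sweep_leading (lap j) (fun zeta zj => IHr zeta (leq_trans zj eta_r)).
rewrite h_fixed; set m := count _ _ => /eqP.
rewrite -subr_eq0 -{1}(mul1r (h eta)) -mulrBl mulf_eq0 subr_eq0.
case/orP => [|/eqP //].
have m_gt0 : (0 < m)%N.
  rewrite -has_count; apply/hasP; have [k k0] := vacancy eta.
  by exists k; rewrite ?mem_lap ?k0.
by rewrite eq_sym lt_eqF // exprn_ilt1 // -lt0n.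
Qed.

Lemma bell_op_unique j f g : sweep t j (lap j) g = g ->
  (forall eta, eta j = 0%N -> g eta = f eta) -> bell_op j f = g.
Proof.
move=> g_fixed g_vacant; apply/eqP; rewrite -subr_eq0; apply/eqP.
apply: (@lap_fixed_eq0 j) => [|eta eta0].
  by rewrite linearB /= lap_bell_op g_fixed.
by rewrite !fn_opE bell_op_vacant // g_vacant // subrr.
Qed.

Lemma scatter_const j k a : scatter t j k (const a) = const a.
Proof.
by apply/ffunP => eta; rewrite scatterE !fn_opE; case: ifP => // _; ring.
Qed.

Lemma bell_op_const j a : bell_op j (const a) = const a.
Proof.
apply: bell_op_unique => //.
by elim: (lap j) => //= k l ->; rewrite scatter_const.
Qed.

Lemma bell_prob_sum1 j eta : \sum_zeta bell_prob t j eta (zeta : C) = 1.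
Proof.
have /ffunP/(_ eta) := bell_op_const j 1; rewrite bell_opE const_fnE => <-.
by apply: eq_bigr => zeta _; rewrite const_fnE mulr1.
Qed.

Lemma bell_hecke_far i j f : i != ordS i -> j != i -> j != ordS i ->
  bell_op j (hecke t i (ordS i) f) = hecke t i (ordS i) (bell_op j f).
Proof.
move=> iS ji jS; apply: bell_op_unique => [|eta eta0].
  by rewrite lap_hecke_far // lap_bell_op.
rewrite !(scatterE, permute_fnE) !bell_op_vacant // !permuteE.
  by rewrite tpermD 1?eq_sym.
by rewrite tpermK.
Qed.

Lemma bell_hecke i f : i != ordS i ->
  bell_op i (hecke t i (ordS i) f) = hecke t i (ordS i) (bell_op (ordS i) f).
Proof.
move=> iS; apply: bell_op_unique => [|eta eta0].
  by rewrite lap_hecke // lap_bell_op.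
rewrite !(scatterE, permute_fnE) eta0 ltn0 bell_op_vacant //.
by rewrite permuteE tpermR.
Qed.

Lemma bell_hecke_dual i f : i != ordS i ->
  bell_op (ordS i) (hecke_dual t i (ordS i) f) =
  hecke_dual t i (ordS i) (bell_op i f).
Proof.
move=> iS; apply: bell_op_unique => [|eta eta0].
  by rewrite lap_hecke_dual // lap_bell_op.
have swap_vacant : swap i (ordS i) eta i = 0%N by rewrite permuteE tpermL.
rewrite !(fn_opE, scatterE, permute_fnE) swapK eta0.
case: posnP => [eta_i|_]; rewrite (bell_op_vacant _ swap_vacant); last by ring.
by rewrite bell_op_vacant.
Qed.

End Bell.

Section GreedySorting.
Local Open Scope nat_scope.
Variables (n : nat) (lam : n.-tuple nat).
Local Notation C := (config lam).
Implicit Types (c : C) (i j k u w : 'I_n) (l : seq 'I_n) (m r : nat).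

(* The deterministic cascade in which every active particle settles at the    *)
(* first weaker site.                                                         *)
Definition greedy_step j c k : C := if c k < c j then swap j k c else c.

Definition greedy j c : C := foldl (greedy_step j) c (lap j).

(* A greedy step puts the smaller species at j and the larger at k, hence     *)
(* commutes with replacing each species c i by the truth value of c i < r: as *)
(* in the 0-1 principle for sorting networks, sorting is studied levelwise.   *)
Lemma greedy_step_level j c k r i : (c j < r) || (r <= c k) ->
  (greedy_step j c k i < r) = (c i < r).
Proof.
rewrite /greedy_step; case: (ltnP (c k)) => // kj jk_r; rewrite permuteE.
have same_level : (c j < r) = (c k < r) by move: jk_r; lia.
by case: tpermP => [->|->|].
Qed.

Lemma greedy_level_low j l c r i : c j < r ->
  (foldl (greedy_step j) c l i < r) = (c i < r).
Proof.
elim: l c => //= k l IHl c jr.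
have step_level i' : (greedy_step j c k i' < r) = (c i' < r).
  by apply: greedy_step_level; rewrite jr.
by rewrite IHl step_level.
Qed.

Definition first_below c r j l : 'I_n := nth j l (find (fun k => c k < r) l).

Lemma first_below_lt c r j l w :
  w \in l -> c w < r -> c (first_below c r j l) < r.
Proof.
move=> wl wr; apply: (@nth_find _ _ (fun k => c k < r)).
by apply/hasP; exists w.
Qed.

Lemma first_below_index c r j l w : uniq l ->
  w \in l -> c w < r -> index (first_below c r j l) l <= index w l.
Proof.
move=> l_uniq wl wr; have l_has : has (fun k => c k < r) l.
  by apply/hasP; exists w.
rewrite index_uniq -?has_find // leqNgt; apply/negP => /(before_find j).
by rewrite nth_index // wr.
Qed.

Lemma greedy_level_high j l c r i : r <= c j ->
  (foldl (greedy_step j) c l i < r) =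
  (c (tperm j (first_below c r j l) i) < r).
Proof.
rewrite /first_below; elim: l c => [|k l IHl] c rj /=.
  by rewrite tperm1 perm1.
have [kr|rk] := ltnP (c k) r.
  have -> : greedy_step j c k = swap j k c.
    by rewrite /greedy_step (leq_trans kr rj).
  by rewrite greedy_level_low permuteE ?tpermL.
have step_level i' : (greedy_step j c k i' < r) = (c i' < r).
  by apply: greedy_step_level; rewrite rk orbT.
by rewrite IHl ?step_level ?(eq_find step_level) // leqNgt step_level -leqNgt.
Qed.

Lemma greedy_min j c k : greedy j c j <= greedy j c k.
Proof.
rewrite leqNgt; apply/negP; set r := greedy j c j => kr.
have : (greedy j c j < r) = false := ltnn r.
have [jr|rj] := ltnP (c j) r; first by rewrite greedy_level_low // jr.
move: kr; rewrite !greedy_level_high // tpermL => kr.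
by rewrite (first_below_lt j (mem_lap _ j) kr).
Qed.

(* Ringing greedily at 0, ..., m - 1 makes the sites m - 1, ..., 0 hold the m *)
(* smallest species in increasing order.                                      *)
Definition settled m c :=
  forall u w, u < m -> ~~ (u < w < m) -> c u <= c w.

Lemma settled_greedy j c : settled j c -> settled j.+1 (greedy j c).
Proof.
move=> c_settled u w; rewrite ltnS leq_eqVlt => /predU1P[/val_inj -> _|uj uwj].
  exact: greedy_min.
rewrite leqNgt; apply/negP; set r := greedy j c u => wr.
have : (greedy j c u < r) = false := ltnn r.
have u_below i : ~~ (u < i < j) -> c i < r -> c u < r.
  by move=> /(c_settled _ _ uj); apply: leq_ltn_trans.
have [jr|rj] := ltnP (c j) r.
  by move: wr; rewrite !greedy_level_low // => /u_below->; move: uwj; lia.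
have Nj : (c j < r) = false by rewrite ltnNge rj.
move: wr; rewrite !greedy_level_high //; set p := first_below _ _ _ _ => wr.
have p_first i : c i < r -> index p (lap j) <= index i (lap j).
  by apply: first_below_index; rewrite ?lap_uniq ?mem_lap.
have wj : w != j by apply: contraNneq uwj => ->; rewrite uj ltnSn.
have {}wr : w != p /\ c w < r.
  by case: tpermP wr => [/eqP|->|_ /eqP]; rewrite ?Nj // (negbTE wj).
case: wr => wp wr; case: tpermP => [uj'|u_p|_ _].
- by rewrite uj' ltnn in uj.
- have := p_first _ wr; rewrite -u_p !index_lap ltnNge (ltnW uj) /= => u_first.
  have {wp} : w != u :> nat by rewrite u_p.
  by have := ltn_ord w; move: u_first uwj; case: ltnP; lia.
- by rewrite (u_below _ _ wr) //; move: uwj; lia.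
Qed.

Lemma settled_unique c c' : settled n c -> settled n c' -> c = c'.
Proof.
have settled_sorted (d : C) : settled n d -> sorted geq (codom d).
  move=> d_settled; rewrite codomE sorted_map.
  have := iota_ltn_sorted 0 n; rewrite -val_enum_ord sorted_map.
  apply: sub_sorted => u w /= uw.
  by apply: d_settled; rewrite // ltnNge ltnW.
move=> /settled_sorted c_sorted /settled_sorted c'_sorted.
have codom_eq : codom c = codom c'.
  apply: (@sorted_eq _ geq) => // [a b d ab bd|a b|].
  - exact: leq_trans ab.
  - by rewrite andbC => /anti_leq.
  - by apply: perm_trans (configP c) _; rewrite perm_sym configP.
apply: config_eqP => k; move: codom_eq; rewrite !codomE => /eq_in_map; apply.
by rewrite mem_enum.
Qed.

Definition greedy_sort c : C := foldl (fun c j => greedy j c) c (enum 'I_n).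

Lemma settled_greedy_sort c : settled n (greedy_sort c).
Proof.
suff settled_take m : m <= n ->
    settled m (foldl (fun c j => greedy j c) c (take m (enum 'I_n))).
  by have := settled_take n (leqnn n); rewrite take_oversize ?size_enum_ord.
elim: m => [|m IHm] mn; first by rewrite take0.
rewrite (take_nth (Ordinal mn)) ?size_enum_ord // foldl_rcons.
have {1}-> : m = nth (Ordinal mn) (enum 'I_n) m by rewrite nth_enum_ord.
by apply: settled_greedy; rewrite nth_enum_ord //; apply/IHm/ltnW.
Qed.

Lemma greedy_sort_merge c c' : greedy_sort c = greedy_sort c'.
Proof. by apply: settled_unique; apply: settled_greedy_sort. Qed.

End GreedySorting.

Section GreedyBell.
Variables (R : realType) (n : nat) (lam : n.-tuple nat) (t : R).
Hypotheses (t_ge0 : 0 <= t) (t_lt1 : t < 1) (lam_vacancy : 0%N \in lam).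
Local Notation C := (config lam).
Local Notation fn := {ffun C -> R^o}.
Implicit Types (h : fn) (eta : C) (j : 'I_n).

Lemma sweep_ge0 j l h :
  (forall eta, 0 <= h eta) -> forall eta, 0 <= sweep t j l h eta.
Proof.
move=> h_ge0; elim: l => //= k l IHl eta; rewrite scatterE.
by case: ifP => // _; rewrite addr_ge0 // mulr_ge0 // subr_ge0 ltW.
Qed.

Lemma sweep_greedy j l h eta : (forall zeta, 0 <= h zeta) ->
  sweep t j l h eta = 0 -> h (foldl (greedy_step j) eta l) = 0.
Proof.
move=> h_ge0; elim: l eta => //= k l IHl eta; rewrite scatterE /greedy_step.
case: ifP => _; last exact: IHl.
have one_sub_t : 0 < 1 - t by rewrite subr_gt0.
move/eqP; rewrite paddr_eq0 ?mulr_ge0 ?sweep_ge0 // ?ltW //.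
by rewrite mulf_eq0 gt_eqF //= => /andP[/eqP/IHl].
Qed.

Lemma bell_greedy j h eta : (forall zeta, 0 <= h zeta) ->
  bell_op t j h eta = 0 -> h (greedy j eta) = 0.
Proof.
move=> h_ge0; rewrite -lap_bell_op // => /sweep_greedy h_greedy.
have greedy_vacant : greedy j eta j = 0%N.
  have [k k0] := vacancy lam_vacancy (greedy j eta).
  by apply/eqP; rewrite -leqn0 -k0 greedy_min.
rewrite -(bell_op_vacant t h greedy_vacant).
by apply: h_greedy; apply: bell_op_ge0.
Qed.

End GreedyBell.

Section PushTASEP.
Variables (R : realType) (n : nat) (lam : n.-tuple nat) (t : R).
Hypotheses (t_ge0 : 0 <= t) (t_lt1 : t < 1) (lam_vacancy : 0%N \in lam).
Local Notation C := (config lam).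
Local Notation fn := {ffun C -> R^o}.
Local Notation const := (@const_fn R C).
Local Notation bell := (fun j => bell_op t j : {linear fn -> fn}).
Local Notation gen := (rate_gen bell).
Local Notation mean := (poisson_mean bell).
Implicit Types (f g : fn) (eta : C) (i j k : 'I_n) (r : 'I_n -> R).

Lemma generator_rate_gen (x : 'I_n -> R) f :
  kernel_op (generator t x : C -> C -> R) f = gen (fun j => (x j)^-1) f.
Proof.
apply/ffunP => eta; rewrite kernel_opE rate_genE (bigD1 eta) //=.
rewrite {1}/generator eqxx mulNr mulr_suml addrC.
have -> : \sum_(zeta | zeta != eta) generator t x eta zeta * f zeta =
    \sum_(zeta | zeta != eta) jump_rate t x eta zeta * f zeta.
  by apply: eq_bigr => zeta neq; rewrite /generator eq_sym (negbTE neq).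
rewrite -sumrB.
transitivity (\sum_zeta jump_rate t x eta zeta * (f zeta - f eta)).
  rewrite [RHS](bigD1 eta) //= subrr mulr0 add0r.
  by apply: eq_bigr => zeta _; rewrite mulrBr.
under [LHS]eq_bigr do rewrite mulr_suml.
rewrite exchange_big; apply: eq_bigr => j _ /=.
rewrite -[f eta in RHS]mul1r -(bell_prob_sum1 t_ge0 t_lt1 lam_vacancy j eta).
rewrite bell_opE mulr_suml -sumrB mulr_sumr.
by apply: eq_bigr => zeta _; rewrite -mulrA mulrBr.
Qed.

Lemma stationary_expectation (x : 'I_n -> R) (pi O : C -> R) a :
  is_stationary t x pi -> mean (fun j => (x j)^-1) [ffun eta => O eta] a ->
  expectation pi O = a.
Proof.
move=> [_ pi_sum1 pi_stat] [g OE]; rewrite -generator_rate_gen in OE.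
have {}OE eta : O eta = kernel_op (generator t x : C -> C -> R) g eta + a.
  by have /ffunP/(_ eta) := OE; rewrite !fn_opE ffunE.
rewrite /expectation; under eq_bigr do rewrite OE mulrDr.
rewrite big_split /= -mulr_suml pi_sum1 mul1r.
under eq_bigr do rewrite kernel_opE mulr_sumr.
rewrite exchange_big big1 ?add0r // => zeta _.
under eq_bigr do rewrite mulrA.
by rewrite -mulr_suml pi_stat mul0r.
Qed.

Lemma lam_arrangementP : perm_eq (codom [ffun i => tnth lam i]) lam.
Proof.
rewrite codomE (eq_map (g := tnth lam)) => [|i]; last by rewrite ffunE.
by rewrite map_tnth_enum.
Qed.

Definition lam_config : C := Config lam_arrangementP.

Lemma bell_mean_unique r f a b : (forall i, 0 < r i) ->
  mean r f a -> mean r f b -> a = b.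
Proof.
move=> r_gt0; apply: (poisson_mean_unique _ _ r_gt0 lam_config) => j.
  by move=> g g_ge0; apply: bell_op_ge0.
exact: bell_op_const.
Qed.

Lemma bell_mean_exists r f : (forall i, 0 < r i) -> exists a, mean r f a.
Proof.
move=> r_gt0.
apply: (poisson_mean_exists _ _ r_gt0 (step := @greedy n lam)
  (word := enum 'I_n)) lam_config => j.
- by move=> g g_ge0; apply: bell_op_ge0.
- exact: bell_op_const.
- by move=> g eta; apply: bell_greedy.
- exact: greedy_sort_merge.
Qed.

Lemma eq_mean r r' f c : r =1 r' -> mean r f c -> mean r' f c.
Proof.
move=> rr' [g ->]; exists g; congr (_ + _); apply/ffunP => eta.
by rewrite !rate_genE; apply: eq_bigr => j _; rewrite rr'.
Qed.

Definition exchange_op (a b : R) i f : fn :=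
  (b * (1 - t)) *: f + (a - b) *: hecke t i (ordS i) f.

Lemma exchange_op_linear a b i : linear (exchange_op a b i).
Proof.
move=> c f g; rewrite /exchange_op hecke_linear; apply/ffunP => eta.
by rewrite !fn_opE; ring.
Qed.

HB.instance Definition _ a b i :=
  GRing.isLinear.Build R fn fn _ _ (@exchange_op_linear a b i).

Lemma bell_exchange_op j a b i f : bell_op t j (exchange_op a b i f) =
  (b * (1 - t)) *: bell_op t j f +
  (a - b) *: bell_op t j (hecke t i (ordS i) f).
Proof. by rewrite linearD !linearZ. Qed.

Lemma bell_exchange_far a b i j f : i != ordS i -> j != i -> j != ordS i ->
  bell_op t j (exchange_op a b i f) = exchange_op a b i (bell_op t j f).
Proof. by move=> iS ji jS; rewrite bell_exchange_op bell_hecke_far. Qed.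

Lemma bell_exchange a b i f : i != ordS i ->
  a *: bell_op t i (exchange_op a b i f) +
    b *: bell_op t (ordS i) (exchange_op a b i f) =
  exchange_op a b i (b *: bell_op t i f + a *: bell_op t (ordS i) f).
Proof.
move=> iS; have := bell_hecke_dual t_ge0 t_lt1 lam_vacancy f iS.
rewrite /hecke_dual linearB linearZ /= => /eqP; rewrite subr_eq => /eqP bell_S.
rewrite !bell_exchange_op bell_hecke // bell_S /exchange_op.
rewrite hecke_linear [hecke t i (ordS i) (_ *: _)]linearZ /=.
move: (hecke _ _ _ (bell_op t i f)) (hecke _ _ _ (bell_op _ _ f)) => Ti TS.
move: (bell_op t i f) (bell_op _ _ f) => Bi BS.
by apply/ffunP => eta; rewrite !fn_opE; ring.
Qed.

Lemma exchange_op_invariant a b i f :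
  (forall eta, f (swap i (ordS i) eta) = f eta) ->
  exchange_op a b i f = (a - t * b) *: f.
Proof.
move=> f_inv; have hecke_f : hecke t i (ordS i) f = f.
  apply/ffunP => eta; rewrite scatterE !permute_fnE swapK f_inv.
  by case: ifP => _ //; ring.
by apply/ffunP => eta; rewrite /exchange_op hecke_f !fn_opE; ring.
Qed.

Lemma gen_exchange r i f (k := ordS i) : i != k ->
  gen r (exchange_op (r i) (r k) i f) =
  exchange_op (r i) (r k) i (gen (r \o tperm i k) f).
Proof.
move=> ik; rewrite /rate_gen [RHS]linear_sum (bigD1 i) //= [RHS](bigD1 i) //=.
rewrite (bigD1 k) 1?eq_sym //= [in RHS](bigD1 k) 1?eq_sym //=.
rewrite tpermL tpermR [LHS]addrA [RHS]addrA; congr (_ + _); last first.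
  apply: eq_bigr => j /andP[ji jk]; rewrite tpermD 1?eq_sym //.
  by rewrite [RHS]linearZ /= [in RHS]linearB /= bell_exchange_far.
rewrite -[RHS]linearD !scalerBr ![_ - _ + _]addrACA -!opprD -!scalerDl.
by rewrite bell_exchange // [RHS]linearB /= [in RHS]linearZ /= (addrC (r k)).
Qed.

Lemma mean_exchange r i f c : i != ordS i ->
  (forall eta, f (swap i (ordS i) eta) = f eta) -> r i != t * r (ordS i) ->
  mean (r \o tperm i (ordS i)) f c -> mean r f c.
Proof.
move=> iS f_inv regular [g fE].
exists ((r i - t * r (ordS i))^-1 *: exchange_op (r i) (r (ordS i)) i g).
rewrite linearZ /= gen_exchange //.
have -> : gen (r \o tperm i (ordS i)) g = f - const c by rewrite fE addrK.
rewrite exchange_op_invariant => [|eta]; last by rewrite !fn_opE f_inv.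
by rewrite scalerA mulVf ?subr_eq0 // scale1r subrK.
Qed.

(* Of the two exchanges relating r and r' := r \o tperm i (ordS i), one is    *)
(* invertible; the one from r' to r gives the claim by uniqueness of means.   *)
Lemma mean_adjacent r i f c : (forall j, 0 < r j) -> i != ordS i ->
  (forall eta, f (swap i (ordS i) eta) = f eta) ->
  mean r f c -> mean (r \o tperm i (ordS i)) f c.
Proof.
move=> r_gt0 iS f_inv f_mean; set r' := r \o _.
have r'_gt0 j : 0 < r' j by apply: r_gt0.
have [singular|regular] := eqVneq (r i) (t * r (ordS i)); last first.
  have [c' f_mean'] := bell_mean_exists f r'_gt0.
  have := mean_exchange iS f_inv regular f_mean'.
  by move/(bell_mean_unique r_gt0 f_mean) ->.
apply: (mean_exchange iS f_inv); last first.
  by apply: eq_mean f_mean => j; rewrite /r' /= tpermK.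
rewrite /r' /= tpermL tpermR singular eq_sym mulrA lt_eqF //.
by rewrite gtr_pMl // mulr_ilt1.
Qed.

Lemma mean_permute (m : nat) (s : {perm 'I_n}) r f c : (forall j, 0 < r j) ->
  (forall i, (m <= i)%N -> (i.+1 < n)%N ->
     forall eta, f (swap i (ordS i) eta) = f eta) ->
  (forall i : 'I_n, (i < m)%N -> s i = i) ->
  mean r f c -> mean (r \o s) f c.
Proof.
move=> r_gt0 f_inv s_fix.
pose P (u : {perm 'I_n}) := forall r', (forall j, 0 < r' j) ->
  mean r' f c -> mean (r' \o u) f c.
suff : P s by apply.
apply: (perm_adjacent_ind _ _ _ s_fix) => {s_fix}.
- by move=> r' _; apply: eq_mean => j /=; rewrite perm1.
- move=> u u' Pu Pu' r' r'_gt0 /(Pu' _ r'_gt0) u'_mean.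
  have := Pu _ (fun j => r'_gt0 (u' j)) u'_mean.
  by apply: eq_mean => j /=; rewrite permM.
- move=> i mi Si_n r' r'_gt0.
  by apply: mean_adjacent => //; [apply: ordS_neq|apply: f_inv].
Qed.

End PushTASEP.

Section Observables.
Variables (n : nat) (lam : n.-tuple nat).
Implicit Types (eta : config lam) (i : 'I_n) (k : nat).

Lemma depends_on_first_swap (T : Type) (O : config lam -> T) k i eta :
  depends_on_first k O -> (k <= i)%N -> (i.+1 < n)%N ->
  O (swap i (ordS i) eta) = O eta.
Proof.
move=> O_first ki Si_n; apply: O_first => j jk.
by rewrite permuteE tpermD // -val_eqE /= ?modn_small //; lia.
Qed.

Lemma probabilityE (R : realType) (pi : config lam -> R) A :
  probability pi A = expectation pi (fun eta => (eta \in A)%:R).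
Proof.
rewrite /probability big_mkcond; apply: eq_bigr => eta _.
by rewrite mulr_natr mulrb.
Qed.

End Observables.

Theorem theorem1p4 (R : realType) (n : nat) (lam : n.-tuple nat)
    (x : 'I_n -> R) (t : R) (k : nat) (s : {perm 'I_n})
    (pi pi' : config lam -> R)
    (n_ge2 : (2 <= n)%N)
    (lam_partition : sorted geq lam)
    (lam_vacancy : 0%N \in lam)
    (x_gt0 : forall i, 0 < x i)
    (t_ge0 : 0 <= t) (t_lt1 : t < 1)
    (k_ltn : (k < n)%N)
    (s_fix : forall i : 'I_n, (i < k)%N -> s i = i)
    (pi_stat : is_stationary t x pi)
    (pi'_stat : is_stationary t (fun i => x (s i)) pi') :
  (forall O : config lam -> R, depends_on_first k O ->
     expectation pi O = expectation pi' O) /\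
  (forall A : {set config lam}, depends_on_first k (fun eta => eta \in A) ->
     probability pi A = probability pi' A).
Proof.
have rate_gt0 i : 0 < (x i)^-1 by rewrite invr_gt0.
have expectation_eq (O : config lam -> R) : depends_on_first k O ->
    expectation pi O = expectation pi' O.
  move=> O_first; pose f : {ffun config lam -> R^o} := [ffun eta => O eta].
  have [c pi_mean] := bell_mean_exists t_ge0 t_lt1 lam_vacancy f rate_gt0.
  have f_inv (i : 'I_n) : (k <= i)%N -> (i.+1 < n)%N ->
      forall eta, f (swap i (ordS i) eta) = f eta.
    by move=> ki Si_n eta; rewrite !(ffunE O) (depends_on_first_swap _ O_first).
  have pi'_mean :=
    mean_permute t_ge0 t_lt1 lam_vacancy rate_gt0 f_inv s_fix pi_mean.
  rewrite (stationary_expectation t_ge0 t_lt1 lam_vacancy pi_stat pi_mean).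
  by rewrite (stationary_expectation t_ge0 t_lt1 lam_vacancy pi'_stat pi'_mean).
split=> // A A_first; rewrite !probabilityE.
by apply: expectation_eq => eta zeta /A_first ->.
Qed.
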